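(* Let $M=(S,\mathcal{I})$ be a matroid given by an independence oracle, $S_0\subseteq S$ a set that contains a basis of $M$ while some basis of $M$ is not contained in $S_0$, and $w\in\mathbb{Z}^S$. Define $w^*$ as follows. If some basis contained in $S_0$ is not a maximum $w$-weight basis of $M$, let $w^*=w$. Otherwise let $B_0\subseteq S_0$ be a maximum $w$-weight basis; if $w-\chi_{B_0}$ is feasible for IM-Not-All, let $w^*=w-\chi_{B_0}$; otherwise let $\delta=\min\{\lceil (w(e)-w(f)+1)/2\rceil : f\in S\setminus B_0,\ e\in C(B_0,f)\setminus\{f\}\}$ and $w^*=w+\delta\cdot(\chi_{S\setminus B_0}-\chi_{B_0})$. Then $w^*$ is an optimal solution of the IM-Not-All instance $(M,S_0,w,\|\cdot\|_\infty)$, and it can be computed in polynomial time.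
   Context: IM-Not-All: find $w^*\in\mathbb{Z}^S$ such that some basis of $M$ contained in $S_0$ is not a maximum $w^*$-weight basis of $M$ (feasibility), minimizing $\|w-w^*\|_\infty=\max_s|w(s)-w^*(s)|$. For a basis $B$ and $f\notin B$, $C(B,f)$ is the unique circuit in $B\cup\{f\}$. $\chi_Z$ is the characteristic vector of $Z$. Polynomial time is measured in independence oracle calls and elementary operations. *)

(* Defs.v *)
From HB Require Import structures.
From mathcomp Require Import all_boot all_order all_algebra.

Set Implicit Arguments.
Unset Strict Implicit.
Unset Printing Implicit Defensive.

Import Order.TTheory GRing.Theory Num.Theory.
Local Open Scope ring_scope.

Record matroid (T : finType) := Matroid {
  indep : pred {set T};
  indep0 : indep set0;
  indepS : forall A B : {set T}, A \subset B -> indep B -> indep A;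
  indep_aug : forall A B : {set T}, indep A -> indep B -> (#|A| < #|B|)%N ->
    exists2 x, x \in B :\: A & indep (x |: A)
}.

Section InverseMatroid.
Variables (T : finType) (M : matroid T).
Implicit Types (A B C X : {set T}) (w : {ffun T -> int}).

Definition basis B : bool := maxset (indep M) B.

Definition circuit C : bool := minset (fun X => ~~ indep M X) C.

Lemma circuit_in_uniq B f C1 C2 :
  indep M B -> circuit C1 -> circuit C2 ->
  C1 \subset f |: B -> C2 \subset f |: B -> C1 = C2.
Proof.
move=> iB cC1 cC2 s1 s2.
have [dC1 mC1] := minsetP cC1; have [dC2 _] := minsetP cC2.
have {}mC1 x : x \in C1 -> indep M (C1 :\ x).
  move=> xC; apply/negPn/negP => /mC1 /(_ (subsetDl _ _)) E.
  by have := setD11 x C1; rewrite E xC.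
have [s12|/subsetPn [e e1 ne2]] := boolP (C1 \subset C2).
  by case/minsetP: cC2 => _ /(_ _ dC1 s12).
have fB : f \notin B.
  apply: contra dC1 => fB; apply: indepS iB.
  by move: s1; rewrite (setUidPr _) // sub1set.
suff [A [iA sA cA eA]] : exists A,
    [/\ indep M A, A \subset f |: B, #|A| = #|B| & C1 :\ e \subset A].
  have neA : e \notin A.
    apply: contra dC1 => e_A; apply: indepS iA.
    by rewrite -(setD1K e1) subUset sub1set e_A.
  suff E : A = (f |: B) :\ e.
    by case/negP: dC2; apply: indepS iA; rewrite E subsetD1 s2.
  apply/eqP; rewrite eqEcard subsetD1 sA neA cA /=.
  have := cardsD1 e (f |: B); rewrite (subsetP s1) // cardsU1 fB add1n.
  by rewrite add1n => -[->].
have c1 : (#|C1 :\ e| <= #|B|)%N.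
  have := subset_leq_card s1.
  by rewrite (cardsD1 e C1) e1 cardsU1 fB ltnS.
have step k A : (#|A| + k = #|B|)%N -> indep M A -> A \subset f |: B ->
    C1 :\ e \subset A -> exists A,
    [/\ indep M A, A \subset f |: B, #|A| = #|B| & C1 :\ e \subset A].
  elim: k A => [|k IH] A; first by rewrite addn0; exists A.
  move=> kA iA sA cA; have ltAB : (#|A| < #|B|)%N by rewrite -kA -addSnnS leq_addr.
  have [x /setDP [xB xA] ixA] := indep_aug iA iB ltAB.
  apply: (IH (x |: A)) => //.
  - by rewrite cardsU1 xA add1n addSnnS.
  - by rewrite subUset sub1set sA !inE xB orbT.
  - exact: subset_trans cA (subsetUr _ _).
apply: (step (#|B| - #|C1 :\ e|)%N (C1 :\ e)); rewrite ?subnKC ?mC1 //.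
exact: subset_trans (subsetDl _ _) s1.
Qed.

Lemma basis_circuit_ex B f : basis B -> f \notin B ->
  exists C, circuit C && (C \subset f |: B).
Proof.
move=> /maxsetP [_ mB] fB.
have dep : ~~ indep M (f |: B).
  apply/negP => /mB /(_ (subsetUr _ _)) E.
  by move: fB; rewrite -E setU11.
have [C cC sC] := @minset_exists _ (fun X => ~~ indep M X) _ dep.
by exists C; rewrite /circuit cC.
Qed.

(* For a basis B and f \notin B, the circuit picked exists and is unique by the
   two lemmas above; set0 is a junk value. *)
Definition fund_circuit B (f : T) : {set T} :=
  odflt set0 [pick C : {set T} | circuit C && (C \subset f |: B)].

Definition weight w A : int := \sum_(s in A) w s.

Definition max_basis w B : bool :=
  basis B && [forall B' : {set T}, basis B' ==> (weight w B' <= weight w B)].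

Definition chi A : {ffun T -> int} := [ffun s => (s \in A)%:R].

Definition dist_oo w w' : nat := \max_(s : T) absz (w s - w' s).

Definition feasible (S0 : {set T}) w : bool :=
  [exists B : {set T}, [&& basis B, B \subset S0 & ~~ max_basis w B]].

Definition optimal (S0 : {set T}) w ws : Prop :=
  feasible S0 ws /\
  forall w', feasible S0 w' -> (dist_oo w ws <= dist_oo w w')%N.

(* pairs (f, e) *)
Definition exchange_pairs B0 : {set T * T} :=
  [set p | (p.1 \notin B0) && (p.2 \in fund_circuit B0 p.1 :\ p.1)].

Definition half_gap w (p : T * T) : int :=
  Num.ceil ((w p.2 - w p.1 + 1)%:Q / 2).

(* The value 0 is junk, for the case of an empty minimum. *)
Definition delta w B0 : int :=
  if [pick p in exchange_pairs B0] is Some p0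
  then half_gap w [arg min_(p < p0 in exchange_pairs B0) half_gap w p]%O
  else 0.

Definition wstar (S0 : {set T}) w B0 : {ffun T -> int} :=
  if feasible S0 w then w
  else if feasible S0 (w - chi B0) then w - chi B0
  else [ffun s => w s + delta w B0 * (chi (~: B0) s - chi B0 s)].

(* Constraint on the choice of B0; wstar does not depend on B0 when w is
   feasible. *)
Definition admissible (S0 : {set T}) w B0 : Prop :=
  ~~ feasible S0 w -> B0 \subset S0 /\ max_basis w B0.

End InverseMatroid.

(* Oracle machine: a while-language on a random-access memory of integers.
   Memory consists of arrays named by nat and indexed by int.  Every constant,
   memory access, arithmetic operation, comparison, oracle call, assignment and
   branching costs 1.  Multiplication is left out on purpose: bit lengths then
   grow by O(1) per step, so that unit cost and bit cost are polynomially
   related. *)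
Inductive expr :=
| Cst of int
| Get of nat & expr             (* x[e] *)
| Plus of expr & expr
| Minus of expr & expr
| Half of expr                  (* rounded down *)
| Le of expr & expr
| Indep of nat.                 (* oracle call on the set stored in array x *)

Inductive cmd :=
| Skip
| Put of nat & expr & expr      (* x[e1] := e2 *)
| Seq of cmd & cmd
| If of expr & cmd & cmd
| While of expr & cmd.

Definition memory := nat -> int -> int.

Definition upd (m : memory) (x : nat) (i v : int) : memory :=
  fun y j => if (y == x) && (j == i) then v else m y j.

Section Semantics.
Variable oracle : (int -> int) -> bool.

Fixpoint eval (m : memory) (e : expr) : int :=
  match e with
  | Cst z => z
  | Get x e1 => m x (eval m e1)
  | Plus e1 e2 => eval m e1 + eval m e2
  | Minus e1 e2 => eval m e1 - eval m e2
  | Half e1 => (eval m e1 %/ 2)%Z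
  | Le e1 e2 => if eval m e1 <= eval m e2 then 1 else 0
  | Indep x => if oracle (m x) then 1 else 0
  end.

Fixpoint cost (e : expr) : nat :=
  match e with
  | Cst _ | Indep _ => 1
  | Get _ e1 | Half e1 => (cost e1).+1
  | Plus e1 e2 | Minus e1 e2 | Le e1 e2 => (cost e1 + cost e2)%N.+1
  end.

(* exec c m t m': started in m, the command c halts in m' after t steps. *)
Inductive exec : cmd -> memory -> nat -> memory -> Prop :=
| ExecSkip m : exec Skip m 0 m
| ExecPut m x e1 e2 :
    exec (Put x e1 e2) m (cost e1 + cost e2)%N.+1 (upd m x (eval m e1) (eval m e2))
| ExecSeq m1 m2 m3 c1 c2 t1 t2 :
    exec c1 m1 t1 m2 -> exec c2 m2 t2 m3 -> exec (Seq c1 c2) m1 (t1 + t2)%N m3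
| ExecIfT m m' e c1 c2 t :
    eval m e != 0 -> exec c1 m t m' -> exec (If e c1 c2) m (cost e + t)%N.+1 m'
| ExecIfF m m' e c1 c2 t :
    eval m e = 0 -> exec c2 m t m' -> exec (If e c1 c2) m (cost e + t)%N.+1 m'
| ExecWhileT m1 m2 m3 e c t1 t2 :
    eval m1 e != 0 -> exec c m1 t1 m2 -> exec (While e c) m2 t2 m3 ->
    exec (While e c) m1 (cost e + t1 + t2)%N.+1 m3
| ExecWhileF m e c : eval m e = 0 -> exec (While e c) m (cost e).+1 m.

Lemma exec_det c m t1 m1 t2 m2 :
  exec c m t1 m1 -> exec c m t2 m2 -> t1 = t2 /\ m1 = m2.
Proof.
move=> h; elim: h t2 m2 => {c m t1 m1}; intros;
  match goal with H : exec _ _ _ _ |- _ /\ _ =>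
    inversion H; subst; clear H end;
  repeat match goal with
  | N : is_true (?x != ?y), E : ?x = ?y |- _ => by rewrite E eqxx in N
  | IH : forall t m, exec ?c ?m1 t m -> _, H : exec ?c ?m1 _ _ |- _ =>
    case: (IH _ _ H) => ? ?; subst; clear H
  end; by [].
Qed.

End Semantics.

Section Encoding.
Variable T : finType.

(* Elements of the ground set are presented to the machine as 0, ..., #|T|-1. *)
Definition code (s : T) : int := (enum_rank s : nat)%:Z.

Definition to_array (f : T -> int) : int -> int :=
  fun i => if [pick s | code s == i] is Some s then f s else 0.

Definition matroid_oracle (M : matroid T) (a : int -> int) : bool :=
  indep M [set s | a (code s) != 0].

(* Cell 0 of array 0 holds #|T|, array 1 holds w, and array 2 holds the
   indicator of S0.  All other cells are 0. *)
Definition input (S0 : {set T}) (w : {ffun T -> int}) : memory :=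
  fun x i => match x with
  | 0 => if i == 0 then #|T|%:Z else 0
  | 1 => to_array w i
  | 2 => to_array (chi S0) i
  | _ => 0
  end.

(* For each element: the binary digits of |w s|, a sign bit and a membership
   bit for S0. *)
Definition input_size (w : {ffun T -> int}) : nat :=
  \sum_(s : T) ((trunc_log 2 `|w s|%N).+1 + 2)%N.

(* The output is read from array 3. *)
Definition computes_within (c : cmd) (M : matroid T) (S0 : {set T})
    (w out : {ffun T -> int}) (bound : nat) : Prop :=
  exists t m, [/\ exec (matroid_oracle M) c (input S0 w) t m,
    (t <= bound)%N & forall s, m 3 (code s) = out s].

End Encoding.

(* Main.v *)
Require Import Defs.
From mathcomp Require Import all_boot all_order all_algebra.
From mathcomp Require Import zify ring lra.

(* Fix any basis B inside S0 and call (f, e) an exchange pair if B - e + f is again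
   a basis.  By symmetric exchange, local optimality over exchange pairs is global
   optimality, so w' is feasible exactly when some exchange pair has w'(f) > w'(e), or
   has f in S0 and w'(f) <> w'(e).  If neither w nor w - chi_B0 is feasible, then B0
   is the only basis inside S0, and feasibility of w' forces w'(f) > w'(e) for some
   exchange pair, which costs at least half of the gap w(e) - w(f) + 1.

   All three cases can be read off two quantities of an arbitrary basis B inside S0:
   whether it has a pair as above for w, and the minimum of w(e) - w(f).  They are
   computed by a double loop over all pairs, without sorting the weights. *)

Set Implicit Arguments.
Unset Strict Implicit.
Unset Printing Implicit Defensive.

Import Order.TTheory GRing.Theory Num.Theory.
Local Open Scope ring_scope.

(** * Bases, exchange pairs and fundamental circuits *)

Section Matroid.
Variables (T : finType) (M : matroid T).
Implicit Types (A B C D S X : {set T}) (w : {ffun T -> int}) (p : T * T).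

(** Iterated augmentation of [A] from [B]. Keeping [D] inside [A :|: B] is what later locates the
    element gained in a symmetric exchange. *)
Lemma indep_extend A B : indep M A -> indep M B -> (#|A| <= #|B|)%N ->
  exists D, [/\ indep M D, A \subset D, D \subset A :|: B & #|D| = #|B|].
Proof.
move=> iA iB; move Ek: (#|B| - #|A|)%N => k.
elim: k A iA Ek => [|k IH] A iA Ek leAB.
  by exists A; split; rewrite ?subsetUl //; lia.
have [|x /setDP[xB xA] ixA] := indep_aug iA iB; first by lia.
have cxA : #|x |: A| = #|A|.+1 by rewrite cardsU1 xA.
have [||D [iD sD Ds cD]] := IH (x |: A) ixA; try lia.
exists D; split=> //; first exact: subset_trans (subsetUr _ _) sD.
by apply: subset_trans Ds _; rewrite -setUA subUset subxx sub1set !inE xB orbT.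
Qed.

Lemma basis_indep B : basis M B -> indep M B.
Proof. by case/maxsetP. Qed.

Lemma indep_leq_basis B D : basis M B -> indep M D -> (#|D| <= #|B|)%N.
Proof.
move=> /maxsetP[iB mB] iD; rewrite leqNgt; apply/negP => ltBD.
have [x /setDP[_ xB] /mB E] := indep_aug iB iD ltBD.
by move: xB; rewrite -E ?subsetUr // setU11.
Qed.

Lemma basis_card B B' : basis M B -> basis M B' -> #|B| = #|B'|.
Proof.
move=> bB bB'; apply/eqP.
by rewrite eqn_leq !indep_leq_basis // basis_indep.
Qed.

Lemma card_indep_basis B D :
  basis M B -> indep M D -> #|D| = #|B| -> basis M D.
Proof.
move=> bB iD cD; apply/maxsetP; split=> // A iA sDA.
by apply/esym/eqP; rewrite eqEcard sDA cD indep_leq_basis.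
Qed.

Lemma basis_sub_eq B B' : basis M B -> basis M B' -> B' \subset B -> B' = B.
Proof.
by move=> bB bB' s; apply/eqP; rewrite eqEcard s (basis_card bB bB') leqnn.
Qed.

Definition exch B p : bool :=
  [&& p.1 \notin B, p.2 \in B & indep M (p.1 |: B :\ p.2)].

Lemma card_swap B f e : f \notin B -> e \in B -> #|f |: B :\ e| = #|B|.
Proof. by move=> fB eB; rewrite cardsU1 !inE (negPf fB) andbF (cardsD1 e B) eB. Qed.

Lemma exch_basis B f e : basis M B -> exch B (f, e) -> basis M (f |: B :\ e).
Proof.
move=> bB /and3P[/= fB eB iB].
exact: card_indep_basis bB iB (card_swap fB eB).
Qed.

(** A dependent [f |: B :\ e] would contain a circuit avoiding [e], which uniqueness identifies with
    [C]. Conversely, if [e] is not in [C], then [C] lies inside [f |: B :\ e]. *)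
Lemma circuit_exch B C f e : basis M B -> f \notin B ->
  circuit M C -> C \subset f |: B -> (e \in C :\ f) = exch B (f, e).
Proof.
move=> bB fB cC sC; rewrite /exch /= fB /= !inE.
have /minsetP[dC mC] := cC.
have CeB : e \in C -> e != f -> e \in B.
  by move=> eC /negPf nef; have := subsetP sC _ eC; rewrite !inE nef.
apply/andP/andP => [[nef eC]|[eB ie]]; split; rewrite ?CeB //.
- apply/negPn/negP => dep.
  have [C2 cC2 sC2] := @minset_exists _ (fun X => ~~ indep M X) _ dep.
  have E : C2 = C.
    apply: circuit_in_uniq (basis_indep bB) cC2 cC _ sC.
    by apply: subset_trans sC2 _; rewrite setUS // subsetDl.
  by have := subsetP sC2 e; rewrite E eC !inE eqxx (negPf nef) => /(_ isT).
- by apply: contraNneq fB => <-.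
- apply: contraNT dC => eC; apply: indepS ie; apply/subsetP => x xC.
  have := subsetP sC x xC; rewrite !inE.
  by case: (x =P e) xC eC => [->->|].
Qed.

(** Trades fundamental circuits for a condition that a single oracle call decides. *)
Lemma exchange_pairsE B : basis M B -> exchange_pairs M B = [set p | exch B p].
Proof.
move=> bB; apply/setP => -[f e]; rewrite !inE /=.
have [fB|fB] /= := boolP (f \in B); first by rewrite /exch /= fB.
rewrite /fund_circuit; case: pickP => [C /andP[cC sC]|no] /=.
  by rewrite -(circuit_exch e bB fB cC sC) !inE.
by have [C] := basis_circuit_ex bB fB; rewrite no.
Qed.

(** Extend [C :\ f], for the circuit [C] in [f |: B], by elements of [B'] to an independent [D] of
    the size of [B']. As [D] cannot contain [C], it misses [f]; augmenting [B' :\ f] from [D] then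
    gives an [e] outside [B'], hence in [C :\ f]. *)
Lemma symmetric_exchange B B' f :
  basis M B -> basis M B' -> f \in B' -> f \notin B ->
  exists e, [/\ e \notin B', exch B (f, e) & basis M (e |: B' :\ f)].
Proof.
move=> bB bB' fB' fB.
have [C /andP[cC sC]] := basis_circuit_ex bB fB.
have /minsetP[dC mC] := cC.
have fC : f \in C.
  apply: contraNT dC => fC; apply: indepS (basis_indep bB).
  apply/subsetP => x xC; have := subsetP sC x xC; rewrite !inE.
  by case: (x =P f) xC fC => [->->|].
have iA : indep M (C :\ f).
  apply/negPn/negP => /mC /(_ (subsetDl _ _)) E.
  by have := setD11 f C; rewrite E fC.
have [|D [iD sD Ds cD]] :=
  indep_extend iA (basis_indep bB'); first exact: indep_leq_basis.
have fD : f \notin D.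
  apply: contra dC => fD; apply: indepS iD.
  by rewrite -(setD1K fC) subUset sub1set fD.
have iB'f : indep M (B' :\ f) by apply: indepS (basis_indep bB'); rewrite subsetDl.
have [|e /setDP[eD eB'f] ie] := indep_aug iB'f iD.
  by rewrite cD (cardsD1 f B') fB' ltnS.
have nef : e != f by apply: contraNneq fD => <-.
have eB' : e \notin B' by move: eB'f; rewrite !inE nef.
have eC : e \in C :\ f by have := subsetP Ds _ eD; rewrite inE (negPf eB') orbF.
exists e; split=> //; first by rewrite -(circuit_exch e bB fB cC sC).
by apply: card_indep_basis bB' ie _; rewrite card_swap.
Qed.

(** * Weights and local optimality *)

Lemma weight_swap w B f e : f \notin B -> e \in B ->
  weight w (f |: B :\ e) = weight w B + w f - w e.
Proof.
move=> fB eB; rewrite /weight big_setU1 ?inE ?(negPf fB) ?andbF //=.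
by rewrite [in RHS](big_setD1 e) //=; ring.
Qed.

(** Induction on the size of [B' :\: B]: a symmetric exchange moves [B'] closer to [B] without
    losing weight. It stays inside [X], because the new element comes from [B]. *)
Lemma local_max w X B : basis M B -> B \subset X ->
  (forall f e, f \in X -> exch B (f, e) -> w f <= w e) ->
  forall B', basis M B' -> B' \subset X -> weight w B' <= weight w B.
Proof.
move=> bB sBX loc B'; move Ek: #|B' :\: B| => k.
elim: k B' Ek => [|k IH] B' Ek bB' sB'X.
  have s : B' \subset B by rewrite -setD_eq0 -cards_eq0 Ek.
  by rewrite (basis_sub_eq bB bB' s).
have [f] : exists f, f \in B' :\: B by apply/card_gt0P; rewrite Ek.
rewrite inE => /andP[fB fB'].
have [e [eB' x bB'']] := symmetric_exchange bB bB' fB' fB.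
have /and3P[_ /= eB _] := x.
have E : (e |: B' :\ f) :\: B = (B' :\: B) :\ f.
  apply/setP => y; rewrite !inE; case: (y =P e) => [->|_] /=.
    by rewrite eB !andbF.
  by rewrite andbCA.
have := IH (e |: B' :\ f); rewrite weight_swap // => IH'.
have h1 := loc f e (subsetP sB'X _ fB') x.
have {}IH' : weight w B' + w e - w f <= weight w B.
  apply: IH' => //.
    by move: Ek; rewrite E (cardsD1 f) !inE fB fB' /= => -[].
  rewrite subUset sub1set (subsetP sBX) //.
  exact: subset_trans (subsetDl _ _) sB'X.
lia.
Qed.

Lemma max_basisP w B : reflect
  (basis M B /\ forall B', basis M B' -> weight w B' <= weight w B)
  (max_basis M w B).
Proof.
apply: (iffP andP) => -[bB mB]; split=> //.
  by move=> B' bB'; have /forallP/(_ B')/implyP := mB; apply.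
by apply/forallP => B'; apply/implyP/mB.
Qed.

Lemma max_basis_weight w B B' :
  max_basis M w B -> max_basis M w B' -> weight w B = weight w B'.
Proof.
move=> /max_basisP[bB mB] /max_basisP[bB' mB'].
by apply/eqP; rewrite eq_le mB ?mB'.
Qed.

(** * Feasibility in terms of exchange pairs *)

Lemma feasiblePn S0 w : reflect
  (forall B, basis M B -> B \subset S0 -> max_basis M w B) (~~ feasible M S0 w).
Proof.
apply: (iffP existsPn) => H B => [bB sB|].
  by have := H B; rewrite bB sB negbK.
by apply/negP => /and3P[bB sB]; rewrite H.
Qed.

Lemma feasibleI S0 w B B' : basis M B -> B \subset S0 -> basis M B' ->
  weight w B < weight w B' -> feasible M S0 w.
Proof.
move=> bB sB bB' lt; apply/existsP; exists B; rewrite bB sB.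
by apply/negP => /max_basisP[_ /(_ _ bB')]; rewrite leNgt lt.
Qed.

Definition gap w p : int := w p.2 - w p.1.

Definition bad_pair S0 w p : bool :=
  (gap w p < 0) || ((p.1 \in S0) && (gap w p != 0)).

(* Without a bad pair, B is locally, hence globally, of maximum weight, and by the
   same argument for -w of minimum weight among the bases inside S0. *)
Lemma feasibleE S0 w B : basis M B -> B \subset S0 ->
  feasible M S0 w = [exists p, exch B p && bad_pair S0 w p].
Proof.
move=> bB sB; apply/idP/existsP => [fw|[[f e] /andP[x]]]; last first.
  have /and3P[/= fB eB _] := x; have bB' := exch_basis bB x.
  have := weight_swap w fB eB; rewrite /bad_pair /gap /= => E.
  (* With a negative gap [B] itself is beaten by the exchanged basis. Otherwise the exchanged basis
     lies inside [S0] and is lighter than [B]. *)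
  have [lt _|le /= /andP[fS ne]] := ltrP (w e - w f) 0.
    by apply: feasibleI bB sB bB' _; rewrite E; lia.
  apply: feasibleI bB' _ bB _; last by rewrite E; lia.
  by rewrite subUset sub1set fS; apply: subset_trans sB; rewrite subsetDl.
apply/existsP; apply: contraLR fw => /existsP no; apply/feasiblePn => B' bB' sB'.
have {}no f e : exch B (f, e) -> w f <= w e /\ (f \in S0 -> w f = w e).
  move=> x; have : ~~ bad_pair S0 w (f, e).
    by apply/negP => b; apply: no; exists (f, e); rewrite x b.
  by rewrite /bad_pair /gap /=; case: (f \in S0) => /=; lia.
have h1 : weight (- w) B' <= weight (- w) B.
  apply: local_max bB sB _ _ bB' sB' => f e fS /no[_ /(_ fS)].
  by rewrite !ffunE => ->.
have wN A : weight (- w) A = - weight w A.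
  by rewrite /weight -sumrN; apply: eq_bigr => s _; rewrite ffunE.
apply/max_basisP; split=> // B2 bB2; apply: (@le_trans _ _ (weight w B)).
  by apply: (@local_max w setT) => // f e _ /no[].
by move: h1; rewrite !wN lerN2.
Qed.

(** * Half gaps and their minimum *)

(** The ceiling of (g + 1) / 2 is the floor of (g + 2) / 2 for an integer g; the floor is the form
    that the machine can compute. *)
Lemma half_gapE w p : half_gap w p = ((gap w p + 2) %/ 2)%Z.
Proof.
rewrite /half_gap -/(gap w p); apply: ceil_def; apply/andP.
move: (gap w p) => g; set q := (_ %/ _)%Z.
have h1 : (q - 1) * 2 < g + 1 by rewrite /q; lia.
have h2 : g + 1 <= q * 2 by rewrite /q; lia.
move: h1 h2; rewrite -(ltr_int rat) -(ler_int rat) !rmorphM /=; split; lra.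
Qed.

Lemma delta_ex B : basis M B -> (exists p, exch B p) -> forall w,
  exists2 p, exch B p & delta M w B = half_gap w p /\
    forall q, exch B q -> half_gap w p <= half_gap w q.
Proof.
move=> bB [p0 x0] w; rewrite /delta exchange_pairsE //.
case: pickP => [p1 /[!inE] x1|/(_ p0)]; last by rewrite inE x0.
case: arg_minP => [|p /[!inE] x m]; first by rewrite inE.
by exists p => //; split=> // q xq; apply: m; rewrite inE.
Qed.

(** Halving is monotone, so the minimum may be taken before it, even though the pair selected by
    [delta] need not have minimal gap. *)
Lemma delta_min_gap w B p : basis M B -> exch B p ->
  (forall q, exch B q -> gap w p <= gap w q) ->
  delta M w B = ((gap w p + 2) %/ 2)%Z.
Proof.
move=> bB x m; have [q xq [-> mq]] := delta_ex bB (ex_intro (exch B) p x) w.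
have := mq _ x; have := m _ xq; rewrite !half_gapE; lia.
Qed.

(** * Optimality of [wstar] *)

Lemma exch_ex S0 B : basis M B -> B \subset S0 ->
  (exists2 B', basis M B' & ~~ (B' \subset S0)) -> exists p, exch B p.
Proof.
move=> bB sB [B' bB' /subsetPn[f fB' fS]].
have fB : f \notin B by apply: contra fS; apply: (subsetP sB).
by have [e [_ x _]] := symmetric_exchange bB bB' fB' fB; exists (f, e).
Qed.

Lemma weight_sub_chi w A B : weight (w - chi A) B = weight w B - #|B :&: A|%:Z.
Proof.
have -> : #|B :&: A|%:Z = \sum_(s in B) chi A s.
  rewrite -sum1_card (big_morph Posz PoszD (erefl _)).
  rewrite [LHS]big_mkcond [RHS]big_mkcond /=; apply: eq_bigr => s _.
  by rewrite ffunE inE; case: (s \in B); case: (s \in A).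
by rewrite /weight -sumrB; apply: eq_bigr => s _; rewrite !ffunE.
Qed.

Lemma dist_oo_ge w w' s : (`|w s - w' s|%N <= dist_oo w w')%N.
Proof. exact: (leq_bigmax (F := fun s => `|w s - w' s|%N)). Qed.

Lemma wstar_optimal S0 w B0 :
  (exists2 B, basis M B & ~~ (B \subset S0)) -> admissible M S0 w B0 ->
  optimal M S0 w (wstar M S0 w B0).
Proof.
move=> out adm; rewrite /wstar; have [fw|nfw] := boolP (feasible M S0 w).
  split=> // w' _; apply: (leq_trans _ (leq0n _)).
  by apply/bigmax_leqP => s _; rewrite subrr.
have [sB mB] := adm nfw; have /max_basisP[bB wB] := mB.
have [fc|nfc] := boolP (feasible M S0 (w - chi B0)).
  (* Distance 1 is best possible here, since distance 0 would force [w' = w], which is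
     infeasible. *)
  split=> // w' fw'; have ne : w != w' by apply: contraNneq nfw => ->.
  apply: (@leq_trans 1); first apply/bigmax_leqP => s _.
    by rewrite !ffunE; case: (s \in B0); rewrite /=; lia.
  rewrite lt0n; apply: contra ne => /eqP d0; apply/eqP/ffunP => s.
  by have := dist_oo_ge w w' s; rewrite d0 leqn0 absz_eq0 subr_eq0 => /eqP.
(* [B] and [B0] both have maximum weight for [w] and for [w - chi B0]. Comparing the two equalities
   gives [B :&: B0] the size of [B0]. *)
have uniqB B : basis M B -> B \subset S0 -> B = B0.
  move=> bB1 sB1.
  have e1 := max_basis_weight (feasiblePn _ _ nfw B bB1 sB1) mB.
  have := max_basis_weight 
    (feasiblePn _ _ nfc B bB1 sB1) (feasiblePn _ _ nfc _ bB sB).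
  rewrite !weight_sub_chi setIid e1 => e2.
  have cB : #|B :&: B0| = #|B0| by lia.
  have s : B0 \subset B.
    by apply/setIidPr/eqP; rewrite eqEcard subsetIr cB leqnn.
  by rewrite (basis_sub_eq bB1 bB s).
have [[f e] x [-> mp]] := delta_ex bB (exch_ex bB sB out) w.
have /and3P[/= fB eB _] := x; set d := half_gap w (f, e).
have := wB _ (exch_basis bB x); rewrite weight_swap // => wef.
have Ed : d = ((w e - w f + 2) %/ 2)%Z by rewrite /d half_gapE.
have d0 : 0 <= d by lia.
split.
  (* The shift lowers the gap of [(f, e)] by 2d, which is at least the gap plus 1, so the exchange
     becomes profitable. *)
  apply: (feasibleI bB sB (exch_basis bB x)); rewrite weight_swap // !ffunE !inE.
  by rewrite (negPf fB) eB /=; lia.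
rewrite -/d in mp; move: d0 {Ed wef}; clearbody d => d0 w'.
move=> /existsP[B /and3P[bB1 sB1]]; rewrite (uniqB B) // => nmax.
(* Only [B0] can witness feasibility of [w'], so it fails to be optimal, hence locally optimal, for
   [w']. *)
have [f' [e' [x' lt]]] : exists f' e', exch B0 (f', e') /\ w' e' < w' f'.
  have : [exists q, exch B0 q && (w' q.2 < w' q.1)].
    apply: contraR nmax => /existsPn no; apply/max_basisP; split=> // B2 bB2.
    apply: (@local_max w' setT) => // f' e' _ x'.
    by have := no (f', e'); rewrite x' /= -leNgt.
  by case/existsP=> -[f' e'] /andP[]; exists f', e'.
(* The gap of this pair is at least 2d - 2 for [w] and at most -1 for [w']. It drops by at least 2d
   - 1, so one of the two weights moves by at least d. *)
have := mp _ x'; rewrite half_gapE /gap /= => led.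
apply: (@leq_trans `|d|%N).
  apply/bigmax_leqP => s _; rewrite !ffunE !inE opprD addrA subrr add0r abszN.
  by case: (s \in B0); rewrite /= ?sub0r ?subr0 ?mulrN1 ?mulr1 ?abszN.
have := dist_oo_ge w w' e'; have := dist_oo_ge w w' f'.
by clear - lt led d0; lia.
Qed.

(** Subtracting [chi B] lowers every gap by 1. Infeasibility of [w] makes all gaps nonnegative, and
    zero when [f] is in [S0]; so a bad pair appears exactly when the least gap is 0. *)
Lemma feasible_sub_chi S0 w B p : basis M B -> B \subset S0 ->
  ~~ feasible M S0 w -> exch B p ->
  (forall q, exch B q -> gap w p <= gap w q) ->
  feasible M S0 (w - chi B) = (gap w p <= 0).
Proof.
move=> bB sB; rewrite !(feasibleE _ bB sB) => /existsPn no x m.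
have gE q : exch B q -> gap (w - chi B) q = gap w q - 1.
  by case/and3P=> h1 h2 _; rewrite /gap !ffunE (negPf h1) h2 /=; lia.
apply/existsP/idP => [[q /andP[xq]]|le].
  by have := no q; have := m q xq; rewrite xq /bad_pair gE //=; lia.
by exists p; rewrite x /bad_pair gE //=; lia.
Qed.

End Matroid.

(** * A program logic with running times *)

(* 'X stands for a bound on the number of iterations of each loop. *)
Fixpoint time (c : cmd) : {poly nat} :=
  match c with
  | Skip => 0
  | Put _ e1 e2 => ((cost e1 + cost e2)%N.+1)%:P
  | Seq c1 c2 => time c1 + time c2
  | If e c1 c2 => ((cost e).+1)%:P + (time c1 + time c2)
  | While e c => 'X * (((cost e).+1)%:P + time c) + ((cost e).+1)%:P
  end.

Lemma horner_nat_mono (p : {poly nat}) (m n : nat) :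
  (m <= n)%N -> (p.[m] <= p.[n])%N.
Proof.
move=> le; rewrite !horner_coef; apply: leq_sum => i _.
apply: leq_mul => //; elim: (i : nat) => // k IH.
by rewrite !exprS leq_mul.
Qed.

Definition var (k : int) : expr := Get 0 (Cst k).
Definition set_var (k : int) (e : expr) : cmd := Put 0 (Cst k) e.
Definition for_loop (k : int) (body : cmd) : cmd :=
  Seq (set_var k (Cst 0))
      (While (Le (Plus (var k) (Cst 1)) (var 0))
             (Seq body (set_var k (Plus (var k) (Cst 1))))).

Section Runs.
Variables (oracle : (int -> int) -> bool) (n : nat).
Implicit Types (c : cmd) (e : expr) (m : memory) (Q : memory -> Prop).

(** Total correctness with a time bound. The postcondition is a predicate that can itself be a
    [runs] claim, so a program is executed symbolically, one command after another. *)
Definition runs c m Q : Prop :=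
  exists t m', [/\ exec oracle c m t m', (t <= (time c).[n])%N & Q m'].

Lemma runs_weaken c m Q Q' : (forall m', Q m' -> Q' m') -> runs c m Q -> runs c m Q'.
Proof. by move=> QQ' [t [m' [x le /QQ' q]]]; exists t, m'. Qed.

Lemma runs_skip m Q : Q m -> runs Skip m Q.
Proof. by move=> q; exists 0, m; split=> //; apply: ExecSkip. Qed.

Lemma runs_put x e1 e2 m Q :
  Q (upd m x (eval oracle m e1) (eval oracle m e2)) -> runs (Put x e1 e2) m Q.
Proof.
move=> q; do 2!eexists; split; [exact: ExecPut| |exact: q].
by rewrite /= hornerC.
Qed.

Lemma runs_seq c1 c2 m Q :
  runs c1 m (fun m' => runs c2 m' Q) -> runs (Seq c1 c2) m Q.
Proof.
move=> [t1 [m1 [x1 le1 [t2 [m2 [x2 le2 q]]]]]].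
exists (t1 + t2)%N, m2; split=> //; first exact: ExecSeq x1 x2.
by rewrite /= hornerD leq_add.
Qed.

Lemma runs_if e c1 c2 m Q :
  (if eval oracle m e == 0 then runs c2 m Q else runs c1 m Q) ->
  runs (If e c1 c2) m Q.
Proof.
case: eqP => [E|/eqP E] [t [m' [x le q]]].
  exists (cost e + t)%N.+1, m'; split=> //; first exact: ExecIfF.
  by rewrite /= !hornerD hornerC; lia.
exists (cost e + t)%N.+1, m'; split=> //; first exact: ExecIfT.
by rewrite /= !hornerD hornerC; lia.
Qed.

End Runs.

Lemma code_inj (T : finType) : injective (@code T).
Proof. by move=> s s' [] /ord_inj /enum_rank_inj. Qed.

Lemma to_arrayE (T : finType) (f : T -> int) s : to_array f (code s) = f s.
Proof.
rewrite /to_array; case: pickP => [s' /eqP/code_inj -> //|/(_ s)].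
by rewrite eqxx.
Qed.

(** The invariant is indexed by the set of visited elements, which hides the enumeration order. It
    has to survive any write to the counter, and the body has to preserve the counter. *)
Lemma runs_for (T : finType) oracle k body (Inv : {set T} -> memory -> Prop) m :
  k != 0 ->
  (forall A m' v, Inv A m' -> Inv A (upd m' 0 k v)) ->
  (forall A m', Inv A m' -> m' 0 0 = #|T|%:Z) ->
  (forall A s m', Inv A m' -> m' 0 k = code s ->
     runs oracle #|T| body m' (fun m'' => Inv (s |: A) m'' /\ m'' 0 k = code s)) ->
  Inv set0 m ->
  runs oracle #|T| (for_loop k body) m (Inv setT).
Proof.
move=> k0 stab size step inv0; apply/runs_seq/runs_put => /=.
set test := Le _ _; set loop := Seq _ _.
(* [i] elements are done and [j] remain; the last summand pays for the failing test. *)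
suff iter j : forall i m', (i + j = #|T|)%N ->
    Inv [set s | (enum_rank s < i)%N] m' -> m' 0 k = i%:Z ->
    exists t m'', [/\ exec oracle (While test loop) m' t m'',
      (t <= j * ((cost test).+1 + (time loop).[#|T|]) + (cost test).+1)%N &
      Inv setT m''].
  have [||t [m' [x le q]]] := iter #|T| 0%N (upd m 0 k 0) (add0n _).
  - apply: stab; suff -> : [set s : T | (enum_rank s < 0)%N] = set0 by [].
    by apply/setP => s; rewrite !inE.
  - by rewrite /upd !eqxx.
  by exists t, m'; split=> //;
    rewrite /= !(hornerD, hornerM, hornerX, hornerC) in le *.
elim: j => [|j IH] i m' ij inv mk.
  exists (cost test).+1, m'; split=> //.
    apply: ExecWhileF; rewrite /= mk (size _ _ inv).
    by case: ifP => //; lia.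
  suff <- : [set s : T | (enum_rank s < i)%N] = setT by [].
  by apply/setP => s; rewrite !inE -[i]addn0 ij ltn_ord.
have lt : (i < #|T|)%N by lia.
pose s : T := enum_val (Ordinal lt).
have Es : code s = i%:Z by rewrite /code enum_valK.
have [t1 [m1 [x1 le1 [inv1 mk1]]]] := step _ s m' inv (etrans mk (esym Es)).
have [||| t2 [m2 [x2 le2 q]]] := IH i.+1 (upd m1 0 k (m1 0 k + 1)).
- lia.
- apply: stab; suff <- : s |: [set s : T | (enum_rank s < i)%N] =
    [set s | (enum_rank s < i.+1)%N] by [].
  apply/setP => s'; rewrite !inE ltnS [RHS]leq_eqVlt; congr (_ || _).
  by rewrite -(inj_eq enum_rank_inj) enum_valK -val_eqE.
- by rewrite /upd !eqxx /= mk1 Es; lia.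
do 2!eexists; split; [|  |exact: q].
  apply: ExecWhileT x2; last by apply: ExecSeq x1 _; apply: ExecPut.
  by rewrite /= mk (size _ _ inv); case: ifP => //; lia.
by rewrite /= !hornerD hornerC /=; move: le1 le2; rewrite /= !hornerD hornerC /=; lia.
Qed.

(** * The program *)

(* Array 4 holds the current set B.  The cells of array 0 used as variables:
   1 and 2 are loop indices (the elements f and e), 3 flags a bad pair, 4 flags that
   an exchange pair was found, 5 is the minimal gap, 6 and 7 are scratch, and the
   output is w - x[8] on B and w + x[9] off B. *)
Definition greedy_step : cmd :=
  If (Get 2 (var 1))
     (Seq (Put 4 (var 1) (Cst 1)) (If (Indep 4) Skip (Put 4 (var 1) (Cst 0))))
     Skip.

Definition record_pair : cmd :=
  Seq (set_var 7 (Minus (Get 1 (var 2)) (Get 1 (var 1))))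
  (Seq (If (Le (var 7) (Cst (-1))) (set_var 3 (Cst 1)) Skip)
  (Seq (If (Get 2 (var 1)) (If (var 7) (set_var 3 (Cst 1)) Skip) Skip)
       (If (var 4)
           (If (Le (var 7) (var 5)) (set_var 5 (var 7)) Skip)
           (Seq (set_var 5 (var 7)) (set_var 4 (Cst 1)))))).

(** The oracle reads a whole array, so [B] is altered in place for the query and restored before the
    pair is recorded. *)
Definition pair_step : cmd :=
  If (Get 4 (var 1)) Skip
  (If (Get 4 (var 2))
     (Seq (Put 4 (var 1) (Cst 1))
     (Seq (Put 4 (var 2) (Cst 0))
     (Seq (set_var 6 (Indep 4))
     (Seq (Put 4 (var 2) (Cst 1))
     (Seq (Put 4 (var 1) (Cst 0))
          (If (var 6) record_pair Skip))))))
     Skip).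

(** The branches are the three cases of [wstar]: [w] feasible, [w - chi B] feasible, and the shift
    by [delta] on both sides. *)
Definition set_shifts : cmd :=
  Seq (set_var 8 (Cst 0))
  (Seq (set_var 9 (Cst 0))
       (If (var 3) Skip
           (If (Le (var 5) (Cst 0)) (set_var 8 (Cst 1))
               (Seq (set_var 8 (Half (Plus (var 5) (Cst 2))))
                    (set_var 9 (var 8)))))).

Definition output_step : cmd :=
  If (Get 4 (var 1))
     (Put 3 (var 1) (Minus (Get 1 (var 1)) (var 8)))
     (Put 3 (var 1) (Plus (Get 1 (var 1)) (var 9))).

Definition wstar_cmd : cmd :=
  Seq (for_loop 1 greedy_step)
  (Seq (set_var 3 (Cst 0))
  (Seq (set_var 4 (Cst 0))
  (Seq (for_loop 1 (for_loop 2 pair_step))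
  (Seq set_shifts
       (for_loop 1 output_step))))).

(** * Memory representation and the greedy basis *)

Section Correctness.
Variables (T : finType) (M : matroid T) (S0 : {set T}) (w : {ffun T -> int}).
Implicit Types (A B : {set T}) (P : {set T * T}) (m : memory).

Local Notation run := (runs (matroid_oracle M) #|T|).

Definition repr B m : Prop :=
  [/\ m 0 0 = #|T|%:Z, forall s, m 1 (code s) = w s,
      forall s, m 2 (code s) = (s \in S0)%:Z &
      forall s, m 4 (code s) = (s \in B)%:Z].

Lemma repr_upd0 B m k v : k != 0 -> repr B m -> repr B (upd m 0 k v).
Proof.
move=> k0 [mn mw mS mB]; split=> //.
by rewrite /upd /= eq_sym (negPf k0).
Qed.

Lemma repr_add B m s : repr B m -> repr (s |: B) (upd m 4 (code s) 1).
Proof.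
move=> [mn mw mS mB]; split=> // s'; rewrite /upd /= (inj_eq (@code_inj T)) !inE.
by case: eqP.
Qed.

Lemma repr_del B m s : repr B m -> repr (B :\ s) (upd m 4 (code s) 0).
Proof.
move=> [mn mw mS mB]; split=> // s'; rewrite /upd /= (inj_eq (@code_inj T)) !inE.
by case: eqP.
Qed.

Lemma repr_oracle B m : repr B m -> matroid_oracle M (m 4) = indep M B.
Proof.
move=> [_ _ _ mB]; congr (indep M _); apply/setP => s; rewrite inE mB.
by case: (s \in B).
Qed.

Lemma repr_input : repr set0 (input S0 w).
Proof.
split=> // s; rewrite /= ?to_arrayE ?inE //.
by rewrite ffunE; case: (s \in S0).
Qed.

Definition greedy_inv A m : Prop := exists B,
  [/\ repr B m, B \subset S0, indep M B &
      forall x, x \in A -> x \in S0 -> x \notin B -> ~~ indep M (x |: B)].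

Lemma updE m x i v y j :
  upd m x i v y j = if (y == x) && (j == i) then v else m y j.
Proof. by []. Qed.

Lemma greedy_spec : run (for_loop 1 greedy_step) (input S0 w) (greedy_inv setT).
Proof.
apply: runs_for => //.
- by move=> A m [B [r _ _ _]]; case: r.
- move=> A s m [B [r sB iB mB]] m1; have [_ _ mS _] := r.
  apply: runs_if; rewrite /= m1 mS.
  have [sS|sS] /= := boolP (s \in S0); last first.
    apply: runs_skip; split=> //; exists B; split=> // x.
    by rewrite !inE => /predU1P[-> /idPn|/mB].
  apply: runs_seq; apply: runs_put; apply: runs_if; rewrite /= m1.
  have r' := repr_add s r; rewrite (repr_oracle r').
  have [i'|d'] /= := boolP (indep M (s |: B)).
    apply: runs_skip; split=> //; exists (s |: B); split=> //.
      by rewrite subUset sub1set sS.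
    move=> x; rewrite !inE => /predU1P[->|xA] xS; first by rewrite eqxx.
    (* An element rejected earlier stays dependent on the enlarged set. *)
    rewrite negb_or => /andP[_ xB]; apply: contra (mB x xA xS xB) => ix.
    by apply: indepS ix; rewrite setUS // subsetUr.
  have sB' : s \notin B.
    by apply: contra d' => s_B; rewrite (setUidPr _) // sub1set.
  apply: runs_put; split; last by rewrite /upd /=.
  exists B; split=> //; last by move=> x; rewrite !inE => /predU1P[->|/mB].
  by have := repr_del s r'; rewrite setU1K //= !updE /= m1.
- exists set0; split; rewrite ?sub0set ?indep0 //; last by move=> x; rewrite inE.
  exact: repr_input.
Qed.

(** * The search over exchange pairs *)

(* x, y, z are the values of the variables 3, 4, 5 once the pairs in P have been
   examined. *)
Definition track B P (x y z : int) : Prop :=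
  (x == 0) = ~~ [exists p in P, exch M B p && bad_pair S0 w p] /\
  if y == 0 then forall p, p \in P -> ~~ exch M B p
  else exists2 p, exch M B p &
    z = gap w p /\ forall q, q \in P -> exch M B q -> gap w p <= gap w q.

Lemma track0 B z : track B set0 0 0 z.
Proof.
split; last by move=> p; rewrite inE.
by rewrite eqxx; apply/esym/existsPn => p; rewrite inE.
Qed.

Lemma track_skip B P p x y z :
  ~~ exch M B p -> track B P x y z -> track B (p |: P) x y z.
Proof.
move=> np [hx h]; split.
  rewrite hx; congr (~~ _); apply: eq_existsb => q; rewrite !inE.
  by case: eqP => [->|]; rewrite ?(negPf np) ?andbF.
case: ifP h => _; first by move=> h q /[!inE] /predU1P[->|/h].
move=> [q xq [-> m]]; exists q => //; split=> // q'.
by rewrite !inE => /predU1P[->|/m //]; rewrite (negPf np).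
Qed.

Lemma track_add B P p x y z : exch M B p -> track B P x y z ->
  track B (p |: P) (if bad_pair S0 w p then 1 else x) 1
    (if (y == 0) || (gap w p <= z) then gap w p else z).
Proof.
move=> xp [hx h]; split.
  have -> : [exists q in p |: P, exch M B q && bad_pair S0 w q] =
      bad_pair S0 w p || [exists q in P, exch M B q && bad_pair S0 w q].
    apply/existsP/orP => [[q /andP[]]|[b|/existsP[q /andP[qP b]]]].
    - rewrite !inE => /predU1P[-> /andP[_ ->]|qP b]; first by left.
      by right; apply/existsP; exists q; rewrite qP.
    - by exists p; rewrite setU11 xp.
    - by exists q; rewrite b !inE qP orbT.
  by case: ifP.
have new : (forall q, q \in P -> exch M B q -> gap w p <= gap w q) ->
    exists2 q, exch M B q & gap w p = gap w q /\
      forall q', q' \in p |: P -> exch M B q' -> gap w q <= gap w q'.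
  by move=> m; exists p => //; split=> // q; rewrite !inE => /predU1P[->|/m].
case: eqP h => /= _.
  by move=> h; apply: new => q /h /negPf->.
move=> [q xq [-> m]]; case: ifP => le.
  by apply: new => q' q'P xq'; apply: le_trans le (m _ q'P xq').
exists q => //; split=> // q'; rewrite !inE => /predU1P[->|/m //].
by lia.
Qed.

(** [track_add] sets the flag to 1, whereas the program leaves a flag that is already nonzero
    alone. *)
Lemma track_found B P x y z : y != 0 -> track B P x 1 z -> track B P x y z.
Proof. by rewrite /track => /negPf->. Qed.

Definition pair_inv B P m : Prop := repr B m /\ track B P (m 0 3) (m 0 4) (m 0 5).

Lemma record_pair_spec B P f e m : pair_inv B P m -> exch M B (f, e) ->
  m 0 1 = code f -> m 0 2 = code e ->
  run record_pair m (fun m' => pair_inv B ((f, e) |: P) m' /\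
    (m' 0 1 = code f /\ m' 0 2 = code e)).
Proof.
move=> [r t] x m1 m2; have [_ mw mS _] := r.
have {t} := track_add x t; rewrite /bad_pair /=; set g := gap w (f, e) => t.
have finish m' : repr B m' -> m' 0 1 = code f -> m' 0 2 = code e ->
    track B ((f, e) |: P) (m' 0 3) (m' 0 4) (m' 0 5) ->
    pair_inv B ((f, e) |: P) m' /\ (m' 0 1 = code f /\ m' 0 2 = code e).
  by split.
apply: runs_seq; apply: runs_put; rewrite /= m1 m2 !mw -[w e - w f]/g.
apply: runs_seq; apply: runs_if; rewrite /= !updE /=.
have -> : (g <= -1) = (g < 0) by lia.
(* Each test of the program is split together with the matching conditional in [t], so in every
   branch [t] yields the tracking claim. *)
case: (g < 0) t => /= t; [apply: runs_put|apply: runs_skip];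
  apply: runs_seq; apply: runs_if; rewrite /= !updE /= m1 mS;
  case: (f \in S0) t => /= t;
  try (apply: runs_if; rewrite /= !updE /=; case: (g == 0) t => /= t);
  (apply: runs_skip || apply: runs_put);
  apply: runs_if; rewrite /= !updE /=; case: (m 0 4 =P 0) t => /= [_|/eqP n4] t;
  try (apply: runs_seq; apply: runs_put; apply: runs_put);
  try (apply: runs_if; rewrite /= !updE /=; case: (g <= m 0 5) t => /= t;
       (apply: runs_skip || apply: runs_put));
  (apply: finish; first [exact: t | exact: track_found n4 t
    | by do ?apply: repr_upd0 | by []]).
Qed.

Lemma pair_step_spec B P f e m : pair_inv B P m ->
  m 0 1 = code f -> m 0 2 = code e ->
  run pair_step m (fun m' => pair_inv B ((f, e) |: P) m' /\
    (m' 0 1 = code f /\ m' 0 2 = code e)).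
Proof.
move=> [r t] m1 m2; have [_ _ _ mB] := r.
have skip : ~~ exch M B (f, e) -> pair_inv B ((f, e) |: P) m.
  by move=> nx; split=> //; apply: track_skip.
apply: runs_if; rewrite /= m1 mB.
have [fB|fB] /= := boolP (f \in B).
  by apply: runs_skip; split=> //; apply: skip; rewrite /exch /= fB.
apply: runs_if; rewrite /= m2 mB.
have [eB|eB] /= := boolP (e \in B); last first.
  by apply: runs_skip; split=> //; apply: skip; rewrite /exch /= (negPf eB) andbF.
have nef : e != f by apply: contraNneq fB => <-.
apply: runs_seq; apply: runs_put; rewrite /= m1.
(* Each updated memory is replaced by a variable together with its lookup equation, which keeps the
   terms small. *)
have {}r := repr_add f r; move: (upd m _ _ _) (updE m 4 (code f) 1) r => m3 E3 r3.
apply: runs_seq; apply: runs_put; rewrite /= E3 /= m2.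
have := repr_del e r3; move: (upd m3 _ _ _) (updE m3 4 (code e) 0) => m4 E4.
have -> : (f |: B) :\ e = f |: B :\ e.
  by apply/setP => x; rewrite !inE; case: (x =P e) nef => // -> /negPf->.
move=> r4; apply: runs_seq; apply: runs_put; rewrite /= (repr_oracle r4).
set b := if _ then _ else _.
have {r4}r5 : repr (f |: B :\ e) (upd m4 0 6 b) by apply: repr_upd0.
move: (upd m4 _ _ _) (updE m4 0 6 b) r5 => m5 E5 r5.
apply: runs_seq; apply: runs_put; rewrite /= E5 /= E4 /= E3 /= m2.
have := repr_add e r5; move: (upd m5 _ _ _) (updE m5 4 (code e) 1) => m6 E6.
have -> : e |: (f |: B :\ e) = f |: B.
  by rewrite setUCA setD1K.
move=> r6; apply: runs_seq; apply: runs_put.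
rewrite /= E6 /= E5 /= E4 /= E3 /= m1.
have := repr_del f r6; move: (upd m6 _ _ _) (updE m6 4 (code f) 0) => m7 E7.
rewrite setU1K // => r7.
(* All writes to [B] have been undone, and in array 0 only the scratch cell 6 may differ from
   [m]. *)
have E k : m7 0 k = if k == 6 then b else m 0 k.
  by rewrite E7 /= E6 /= E5 /= E4 /= E3 /=.
have inv7 : pair_inv B P m7 by split=> //; rewrite !E /=.
apply: runs_if; rewrite /= E /= /b.
have [i|d] /= := boolP (indep M _).
  by apply: record_pair_spec; rewrite ?E // /exch /= fB eB.
apply: runs_skip; rewrite !E /=; split=> //; split=> //; rewrite !E /=.
by apply: track_skip t; rewrite /exch /= (negPf d) !andbF.
Qed.

Lemma pair_loop_spec B m : pair_inv B set0 m ->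
  run (for_loop 1 (for_loop 2 pair_step)) m (pair_inv B setT).
Proof.
move=> inv.
have -> : setT = setX setT setT :> {set T * T} by apply/setP => -[x y]; rewrite !inE.
apply: (@runs_for _ _ _ _ (fun A => pair_inv B (setX A setT))) => //.
- by move=> A m' [[]].
- move=> A f m' invA m1.
  have -> : setX (f |: A) [set: T] = setX A setT :|: setX [set f] setT.
    by apply/setP => -[x y]; rewrite !inE !andbT orbC.
  (* The inner invariant also fixes the outer counter, which the body reads and the outer loop needs
     back. *)
  pose Inv2 A2 m'' :=
    pair_inv B (setX A setT :|: setX [set f] A2) m'' /\ m'' 0 1 = code f.
  apply: (@runs_for _ _ _ _ Inv2) => //.
  + by move=> A2 m2 [[[]]].
  + move=> A2 e m3 [inv3 m31] m32.
    apply: runs_weaken (pair_step_spec inv3 m31 m32) => m4 [inv4 [m41 m42]].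
    split=> //; split=> //; congr (pair_inv B _ m4): inv4.
    apply/setP => -[x y]; rewrite !inE xpair_eqE /=.
    by case: (x == f); case: (y == e); rewrite /= ?orbT.
  + by split=> //; congr (pair_inv B _ m'): invA;
    apply/setP => -[x y]; rewrite !inE andbF orbF.
- by congr (pair_inv B _ m): inv; apply/setP => -[x y]; rewrite !inE.
Qed.

(** * Output, and agreement with [wstar] *)

Lemma set_shifts_spec B m : pair_inv B setT m ->
  run set_shifts m (fun m' => repr B m' /\ (m' 0 8, m' 0 9) =
    if m 0 3 != 0 then (0, 0)
    else if m 0 5 <= 0 then (1, 0)
    else (((m 0%N 5 + 2) %/ 2)%Z, ((m 0%N 5 + 2) %/ 2)%Z)).
Proof.
move=> [r _]; apply: runs_seq; apply: runs_put; apply: runs_seq; apply: runs_put.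
have {}r : repr B (upd (upd m 0 8 0) 0 9 0) by do ?apply: repr_upd0.
apply: runs_if; rewrite /= !updE /=; case: eqP => _ /=; last by apply: runs_skip.
apply: runs_if; rewrite /= !updE /=; case: (m 0 5 <= 0) => /=.
  by apply: runs_put; split=> //; apply: repr_upd0.
by apply: runs_seq; apply: runs_put; apply: runs_put.
Qed.

Lemma output_spec B m : repr B m ->
  run (for_loop 1 output_step) m (fun m' => forall s,
    m' 3 (code s) = w s + (if s \in B then - m 0 8 else m 0 9)).
Proof.
move=> r; pose Inv A m' := [/\ repr B m', m' 0 8 = m 0 8, m' 0 9 = m 0 9 &
  forall s, s \in A -> m' 3 (code s) = w s + (if s \in B then - m 0 8 else m 0 9)].
suff: run (for_loop 1 output_step) m (Inv setT).
  by apply: runs_weaken => m' [_ _ _ H] s; apply: H; rewrite inE.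
apply: runs_for => //; last by split=> // s; rewrite inE.
  by move=> A m' [[]].
move=> A s m' [r' m8 m9 out] m1; have [_ mw _ mB] := r'.
apply: runs_if; rewrite /= m1 mB.
have fin v : v = w s + (if s \in B then - m 0 8 else m 0 9) ->
    Inv (s |: A) (upd m' 3 (code s) v).
  move=> Ev; split=> // s'; rewrite !inE updE /= (inj_eq (@code_inj T)).
  by case: eqP => [-> //|_] /=; apply: out.
case: (s \in B) fin => /= fin; apply: runs_put; split=> //=;
  by rewrite m1 mw ?m8 ?m9; apply: fin.
Qed.

(** Were [B] smaller than [B'], augmentation from [B'] would add an element of [S0], against
    maximality. *)
Lemma greedy_basis B : (exists2 B', basis M B' & B' \subset S0) ->
  B \subset S0 -> indep M B ->
  (forall x, x \in S0 -> x \notin B -> ~~ indep M (x |: B)) -> basis M B.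
Proof.
move=> [B' bB' sB'] sB iB mB; apply: (card_indep_basis bB' iB).
apply/eqP; rewrite eqn_leq (indep_leq_basis bB' iB) /= leqNgt; apply/negP => lt.
have [x /setDP[xB' xB]] := indep_aug iB (basis_indep bB') lt.
by apply/negP/mB => //; apply: (subsetP sB').
Qed.

(** Some basis leaves [S0], so an exchange pair exists; hence [z] is a true minimum of gaps and the
    default value of [delta] never enters. *)
Lemma wstar_trackE B x y z : basis M B -> B \subset S0 ->
  (exists2 B', basis M B' & ~~ (B' \subset S0)) -> track B setT x y z ->
  forall s, wstar M S0 w B s = w s +
    (let: (a, b) := if x != 0 then (0, 0) else if z <= 0 then (1, 0)
     else (((z + 2) %/ 2)%Z, ((z + 2) %/ 2)%Z) in if s \in B then - a else b).
Proof.
move=> bB sB out [hx hy] s; rewrite /wstar.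
have -> : feasible M S0 w = (x != 0).
  rewrite (feasibleE w bB sB) hx negbK.
  by apply: eq_existsb => p; rewrite inE.
case: eqP => x0 /=; last by rewrite if_same ?addr0 //; case: ifP; rewrite addr0.
have nf : ~~ feasible M S0 w.
  rewrite (feasibleE w bB sB); move: hx; rewrite x0 eqxx => /esym.
  by apply: contra => /existsP[p h]; apply/existsP; exists p; rewrite inE.
have [p0 x0'] := exch_ex bB sB out.
case: eqP hy => [_ /(_ p0 (in_setT _))|_ [p xp [-> m]]]; first by rewrite x0'.
have {}m q : exch M B q -> gap w p <= gap w q by apply: m; rewrite inE.
rewrite (feasible_sub_chi bB sB nf xp m); case: ifP => _.
  by rewrite !ffunE; case: (s \in B); rewrite /= ?subr0 ?addr0.
rewrite (delta_min_gap bB xp m) !ffunE inE.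
by case: (s \in B); rewrite /= ?sub0r ?subr0 ?mulr1 ?mulrN1.
Qed.

(** This is why the greedy phase may ignore weights: if [w] is infeasible, every basis inside [S0]
    has maximum weight. *)
Lemma admissible_basis B : basis M B -> B \subset S0 -> admissible M S0 w B.
Proof. by move=> bB sB /feasiblePn/(_ B bB sB). Qed.

Lemma wstar_cmd_spec :
  (exists2 B, basis M B & B \subset S0) ->
  (exists2 B, basis M B & ~~ (B \subset S0)) ->
  run wstar_cmd (input S0 w) (fun m' => exists2 B, admissible M S0 w B &
    forall s, m' 3 (code s) = wstar M S0 w B s).
Proof.
move=> inS outS; apply: runs_seq; apply: runs_weaken greedy_spec.
move=> m1 [B [r1 sB iB mB]].
have bB : basis M B by apply: (greedy_basis inS sB iB) => x; apply: mB; rewrite inE.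
apply: runs_seq; apply: runs_put; apply: runs_seq; apply: runs_put; apply: runs_seq.
apply: runs_weaken (@pair_loop_spec B _ _); last first.
  by split; [do ?apply: repr_upd0|rewrite !updE; apply: track0].
move=> m2 inv2; apply: runs_seq; apply: runs_weaken (set_shifts_spec inv2).
move=> m3 [r3 E3]; apply: runs_weaken (output_spec r3) => m4 E4.
exists B; first exact: admissible_basis.
by move=> s; rewrite E4 (wstar_trackE bB sB outS inv2.2) -E3.
Qed.

Lemma card_leq_input_size : (#|T| <= input_size w)%N.
Proof.
rewrite /input_size -sum1_card; apply: leq_sum => s _.
by rewrite addn2.
Qed.

End Correctness.

Theorem theorem7p2 :
  (forall (T : finType) (M : matroid T) (S0 : {set T}) (w : {ffun T -> int}),
     (exists2 B : {set T}, basis M B & B \subset S0) ->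
     (exists2 B : {set T}, basis M B & ~~ (B \subset S0)) ->
     forall B0 : {set T}, admissible M S0 w B0 ->
       optimal M S0 w (wstar M S0 w B0)) /\
  (exists (c : cmd) (p : {poly nat}),
     forall (T : finType) (M : matroid T) (S0 : {set T}) (w : {ffun T -> int}),
       (exists2 B : {set T}, basis M B & B \subset S0) ->
       (exists2 B : {set T}, basis M B & ~~ (B \subset S0)) ->
       exists2 B0 : {set T}, admissible M S0 w B0 &
         computes_within c M S0 w (wstar M S0 w B0) p.[input_size w]).
Proof.
split=> [T M S0 w _ outS B0 adm|]; first exact: wstar_optimal.
exists wstar_cmd, (time wstar_cmd) => T M S0 w inS outS.
have [t [m [x le [B adm out]]]] := wstar_cmd_spec w inS outS.
exists B => //; exists t, m; split=> //; apply: leq_trans le _.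
(* The time is a polynomial with natural coefficients in the number of elements, which the input
   size bounds. *)
exact/horner_nat_mono/card_leq_input_size.
Qed.
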